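(* Let $X$ and $Y$ be compact metric spaces with metrics $d_X$ and $d_Y$ respectively, and let $K$ and $M$ be compact Hausdorff spaces. Let $T$ be a homomorphism from $\operatorname{Lip}(X, C(K))$ into $\operatorname{Lip}(Y, C(M))$, written in its canonical form given by $(\mathcal{D}, \varphi, \psi)$ (see context). Then $T$ is a compact operator if and only if both (iii) and (iv) hold: (iii) For every $\varepsilon > 0$ there exists $\delta > 0$ such that whenever $(y,\eta), (y',\eta) \in \mathcal{D}$ and $0 < d_Y(y,y') < \delta$, one has $$\frac{d_X(\varphi(y,\eta), \varphi(y',\eta))}{d_Y(y,y')} < \varepsilon.$$ (iv) For every $y \in Y$, the set $\mathcal{D}_y = \{ \eta \in M : (y,\eta) \in \mathcal{D} \}$ is a union of finitely many disjoint clopen sets $\Omega_y^1, \ldots, \Omega_y^{n_y}$ such that the map $\eta \mapsto \psi(y,\eta)$ is constant on $\Omega_y^i$ for each $i = 1, \ldots, n_y$.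
   Context: For a compact Hausdorff space $K$, $C(K)$ is the Banach algebra of complex-valued continuous functions on $K$ with the supremum norm. For a compact metric space $X$, $\operatorname{Lip}(X, C(K))$ is the Banach algebra (pointwise operations) of all functions $f : X \to C(K)$ with $\mathcal{L}_{X,C(K)}(f) = \sup_{x \ne x'} \|f(x) - f(x')\|_{C(K)} / d_X(x,x') < \infty$, with norm $\|f\| = \sup_{x \in X} \|f(x)\|_{C(K)} + \mathcal{L}_{X,C(K)}(f)$. An element $f$ is regarded as a function on $X \times K$ via $f(x,\xi) = [f(x)](\xi)$; similarly for $\operatorname{Lip}(Y, C(M))$. A homomorphism is a map preserving addition, scalar multiplication and multiplication. A set is clopen if it is both open and closed; clopen sets may be empty. Canonical form: every homomorphism $T : \operatorname{Lip}(X, C(K)) \to \operatorname{Lip}(Y, C(M))$ is of the form $$(Tf)(y,\eta) = f(\varphi(y,\eta), \psi(y,\eta)) \text{ if } (y,\eta) \in \mathcal{D}, \qquad (Tf)(y,\eta) = 0 \text{ if } (y,\eta) \in (Y \times M)\setminus \mathcal{D},$$ for all $f \in \operatorname{Lip}(X, C(K))$, where $\mathcal{D} \subset Y \times M$ is clopen and $\varphi : \mathcal{D} \to X$, $\psi : \mathcal{D} \to K$ are continuous and satisfy: (i) there is $L \ge 0$ with $d_X(\varphi(y,\eta), \varphi(y',\eta)) \le L\, d_Y(y,y')$ whenever $(y,\eta), (y',\eta) \in \mathcal{D}$ and $y \neq y'$; (ii) there is $r > 0$ independent of $\eta$ such that for every $\eta \in M$ the set $\mathcal{D}^\eta = \{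 y \in Y : (y,\eta) \in \mathcal{D}\}$ is a union of finitely many disjoint clopen subsets $V^\eta_1, \ldots, V^\eta_{n_\eta}$ of $Y$ with $y \mapsto \psi(y,\eta)$ constant on each $V_i^\eta$ and $d_Y(V_i^\eta, V_j^\eta) \ge r$ for $i \ne j$ (where $d_Y(A,B) = \inf\{d_Y(y,y') : y \in A, y' \in B\}$, and $=\infty$ if $A$ or $B$ is empty). *)

(* Defs.v *)
From HB Require Import structures.
From mathcomp Require Import all_boot all_order all_algebra.
From mathcomp Require Import complex.
From mathcomp Require Import all_classical all_reals all_analysis.

Set Implicit Arguments.
Unset Strict Implicit.
Unset Printing Implicit Defensive.

Import Order.TTheory GRing.Theory Num.Theory numFieldNormedType.Exports.

Local Open Scope classical_set_scope.
Local Open Scope ring_scope.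
Local Open Scope complex_scope.

HB.mixin Record isCompactSpace T & Topological T := {
  compact_space : compact [set: T]
}.

#[short(type="compactType")]
HB.structure Definition CompactSpace := { T of Topological T & isCompactSpace T }.

#[short(type="compactMetricType")]
HB.structure Definition CompactMetric (R : realType) :=
  { T of Metric R T & isCompactSpace T }.

(* The norm of a complex normed space takes its values in R[i], ordered so that
   they are nonnegative reals; [rnorm] is the same number seen in R. *)
Definition rnorm (R : realType) (V : normedModType R[i]) (v : V) : R :=
  complex.Re `|v|.

Section rnorm_theory.
Context {R : realType} {V : normedModType R[i]}.
Implicit Types u v : V.

Lemma rnormE v : `|v| = (rnorm v)%:C.
Proof. by rewrite /rnorm RRe_real// ger0_real. Qed.

Lemma rnorm_ge0 v : 0 <= rnorm v.
Proof. by rewrite -lecR -rnormE; exact: normr_ge0. Qed.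

Lemma rnorm0 : rnorm (0 : V) = 0.
Proof. by rewrite /rnorm normr0. Qed.

Lemma rnorm0_eq0 v : rnorm v = 0 -> v = 0.
Proof. by move=> v0; apply/normr0_eq0; rewrite rnormE v0. Qed.

Lemma rnormD u v : rnorm (u + v) <= rnorm u + rnorm v.
Proof. by rewrite -lecR rmorphD/= -!rnormE ler_normD. Qed.

Lemma rnormN v : rnorm (- v) = rnorm v.
Proof. by rewrite /rnorm normrN. Qed.

Lemma rnorm_dist u v : `|rnorm u - rnorm v| <= rnorm (u - v).
Proof.
have dist_le (a b : V) : rnorm a - rnorm b <= rnorm (a - b).
  by rewrite lerBlDr; have := rnormD (a - b) b; rewrite subrK.
by rewrite ler_norml lerNl opprB -{1}(opprB v u) rnormN !dist_le.
Qed.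

Lemma rnormZ (a : R[i]) v : rnorm (a *: v) = rnorm (a : R[i]^o) * rnorm v.
Proof.
by apply: (@complexI R); rewrite rmorphM/= -!rnormE normrZ.
Qed.

End rnorm_theory.

Section sup_nonneg.
Context {R : realType}.
Implicit Types (A : set R) (c : R).

(* also for A = set0, where sup A = 0 *)
Lemma sup_le_ub0 A c : 0 <= c -> (forall a, A a -> a <= c) -> sup A <= c.
Proof.
move=> c0 Ac; have [->|/set0P A0] := eqVneq A set0; first by rewrite sup0.
exact: ge_sup.
Qed.

Lemma sup_nneg A : (forall a, A a -> 0 <= a) -> 0 <= sup A.
Proof.
move=> A0; have [[[a Aa] ubA]|nA] := pselect (has_sup A).
  by rewrite (le_trans (A0 _ Aa))// ub_le_sup.
by rewrite sup_out.
Qed.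

End sup_nonneg.


(* C(K), of which the norm below is defined when K is compact *)
Definition cfun (R : realType) (K : topologicalType) : Type :=
  continuousType K R[i]^o.

Section cfun_algebra.
Context {R : realType} {K : topologicalType}.

Definition cfun_pred : {pred K -> R[i]^o} := mem [set f | continuous f].

Definition cfun_Sub (f : K -> R[i]^o) (fP : f \in cfun_pred) : cfun R K :=
  mkcts (set_mem fP).

Lemma cfun_rect (P : cfun R K -> Type) :
  (forall f (fP : f \in cfun_pred), P (cfun_Sub fP)) -> forall u, P u.
Proof.
move=> Psub [f [[fc]]].
by suff -> : fc = set_mem (@mem_set _ [set f | _] f fc) by exact: Psub.
Qed.

Lemma cfun_SubK f (fP : f \in cfun_pred) : cfun_Sub fP = f :> (_ -> _).
Proof. by []. Qed.

HB.instance Definition _ := isSub.Build _ _ (cfun R K) cfun_rect cfun_SubK.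
HB.instance Definition _ := [Choice of cfun R K by <:].

Lemma cfun_continuous (f : cfun R K) : continuous (f : K -> R[i]^o).
Proof. exact: cts_fun. Qed.

Lemma cfun_subring_closed : subring_closed cfun_pred.
Proof.
split=> [|f g /set_mem fc /set_mem gc|f g /set_mem fc /set_mem gc].
- by apply/mem_set => x; exact: cvg_cst.
- by apply/mem_set => x; apply: cvgB; [exact: fc|exact: gc].
- apply/mem_set => x.
  apply: cvgM.
    exact: fc.
  exact: gc.
Qed.
HB.instance Definition _ := GRing.isSubringClosed.Build _
  cfun_pred cfun_subring_closed.
HB.instance Definition _ := GRing.SubChoice_isSubComPzRing.Build
  (K -> R[i]^o) cfun_pred (cfun R K) cfun_subring_closed.

Lemma cfun_subsemimod_closed : GRing.subsemimod_closed cfun_pred.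
Proof.
split; first by split; [exact: rpred0|exact: rpredD].
move=> a f /set_mem fc; apply/mem_set => x.
by apply: cvgZr; exact: fc.
Qed.
HB.instance Definition _ := GRing.SubZmodule_isSubLmodule.Build
  R[i] (K -> R[i]^o) cfun_pred (cfun R K) cfun_subsemimod_closed.

Lemma cfunB (f g : cfun R K) x : (f - g) x = f x - g x.
Proof. by []. Qed.

Lemma cfunD (f g : cfun R K) x : (f + g) x = f x + g x.
Proof. by []. Qed.

Lemma cfunM (f g : cfun R K) x : (f * g) x = f x * g x.
Proof. by []. Qed.

Lemma cfunZ (a : R[i]) (f : cfun R K) x : (a *: f) x = a *: f x.
Proof. by []. Qed.

End cfun_algebra.

Definition sup_norm (R : realType) (T : Type) (V : normedModType R[i])
  (f : T -> V) : R := sup [set rnorm (f t) | t in setT].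

Section sup_norm_theory.
Context {R : realType} {T : Type} {V : normedModType R[i]}.
Implicit Types f g : T -> V.

Definition sup_bounded f := has_ubound [set rnorm (f t) | t in setT].

Lemma sup_norm_ub f t : sup_bounded f -> rnorm (f t) <= sup_norm f.
Proof. by move=> bf; apply: ub_le_sup => //; exists t. Qed.

Lemma sup_norm_le f c : 0 <= c -> (forall t, rnorm (f t) <= c) ->
  sup_norm f <= c.
Proof. by move=> c0 fc; apply: sup_le_ub0 => // _ [t _ <-]; exact: fc. Qed.

Lemma sup_norm_ge0 f : 0 <= sup_norm f.
Proof. by apply: sup_nneg => _ [t _ <-]; exact: rnorm_ge0. Qed.

Lemma sup_normD f g : sup_bounded f -> sup_bounded g ->
  sup_norm (f \+ g) <= sup_norm f + sup_norm g.
Proof.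
move=> bf bg; apply: sup_norm_le => [|t].
  by rewrite addr_ge0// sup_norm_ge0.
by rewrite (le_trans (rnormD _ _))// lerD// sup_norm_ub.
Qed.

Lemma sup_normZ_le (a : R[i]) f : sup_bounded f ->
  sup_norm (a \*: f) <= rnorm (a : R[i]^o) * sup_norm f.
Proof.
move=> bf; apply: sup_norm_le => [|t].
  by rewrite mulr_ge0 ?sup_norm_ge0 ?rnorm_ge0.
by rewrite rnormZ ler_wpM2l ?rnorm_ge0// sup_norm_ub.
Qed.

Lemma sup_norm0_eq0 f t : sup_bounded f -> sup_norm f = 0 -> f t = 0.
Proof.
move=> bf f0; apply: rnorm0_eq0; apply/eqP.
by rewrite eq_le rnorm_ge0 andbT -f0 sup_norm_ub.
Qed.

End sup_norm_theory.

Lemma compact_sup_bounded (R : realType) (T : compactType)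
  (V : normedModType R[i]) (f : T -> V) : continuous f -> sup_bounded f.
Proof.
move=> fc; pose h t : R^o := rnorm (f t).
have hc : continuous h.
  move=> t; apply/cvgrPdist_lt => e e0.
  have e0C : 0 < e%:C :> R[i] by rewrite ltcR.
  have /cvgrPdist_lt/(_ _ e0C) := fc t.
  apply: filterS => u; rewrite rnormE ltcR; apply: le_lt_trans.
  exact: rnorm_dist.
have : compact (h @` setT).
  apply: continuous_compact (compact_space).
  exact: continuous_subspaceT.
move=> /compact_bounded/ex_strict_bound_gt0[M M0 fM].
exists M => _ [t _ <-].
by rewrite (le_trans (ler_norm _))// ltW//; apply: (fM (h t)); exists t.
Qed.

Lemma homogeneous_of_le (R : realType) (V : lmodType R[i]) (N : V -> R) :
  (forall v, 0 <= N v) ->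
  (forall a v, N (a *: v) <= rnorm (a : R[i]^o) * N v) ->
  forall a v, N (a *: v) = rnorm (a : R[i]^o) * N v.
Proof.
move=> N0 Nle a v; apply/eqP; rewrite eq_le Nle/=.
have [->|a0] := eqVneq a 0; first by rewrite rnorm0 mul0r N0.
have a_gt0 : 0 < rnorm (a : R[i]^o).
  rewrite lt_neqAle rnorm_ge0 andbT eq_sym.
  by apply: contra_neq a0 => /rnorm0_eq0.
have aV : rnorm (a : R[i]^o) * rnorm (a^-1 : R[i]^o) = 1.
  by rewrite -rnormZ /= /rnorm [a *: _]mulfV// normr1.
have : N (a^-1 *: (a *: v)) <= rnorm (a^-1 : R[i]^o) * N (a *: v) by exact: Nle.
rewrite scalerA mulVf// scale1r => h.
rewrite (le_trans (ler_wpM2l (ltW a_gt0) h))//.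
by rewrite mulrA aV mul1r.
Qed.

Section cfun_norm.
Context {R : realType} {K : compactType}.
Implicit Types f g : cfun R K.

Lemma cfun_bounded f : sup_bounded (f : K -> R[i]^o).
Proof. by apply: compact_sup_bounded; exact: cfun_continuous. Qed.

Definition cfun_norm f : R := sup_norm (f : K -> R[i]^o).

Let cfun_normD f g : (cfun_norm (f + g))%:C <= (cfun_norm f)%:C + (cfun_norm g)%:C.
Proof. by rewrite -rmorphD/= lecR sup_normD//; exact: cfun_bounded. Qed.

Let cfun_normZ (a : R[i]) f : (cfun_norm (a *: f))%:C = `|a| * (cfun_norm f)%:C.
Proof.
rewrite (@rnormE _ R[i]^o a) -rmorphM/= (@homogeneous_of_le _ _ cfun_norm)//.
  by move=> ?; exact: sup_norm_ge0.
by move=> ? ?; apply: sup_normZ_le; exact: cfun_bounded.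
Qed.

Let cfun_norm0_eq0 f : (cfun_norm f)%:C = 0 -> f = 0.
Proof.
move=> /(@complexI R) f0; apply/val_inj/funext => x /=.
by apply: sup_norm0_eq0 f0; exact: cfun_bounded.
Qed.

HB.instance Definition _ := Lmodule_isNormed.Build R[i] (cfun R K)
  cfun_normD cfun_normZ cfun_norm0_eq0.

Lemma cfun_rnorm f : rnorm f = sup_norm (f : K -> R[i]^o).
Proof. by []. Qed.

Lemma cfun_rnormM f g : rnorm (f * g) <= rnorm f * rnorm g.
Proof.
apply: sup_norm_le => [|x]; first by rewrite mulr_ge0 ?rnorm_ge0.
by rewrite cfunM rnormZ ler_pM ?rnorm_ge0//; apply: sup_norm_ub;
  exact: cfun_bounded.
Qed.

End cfun_norm.

Definition lip_quotients (R : realType) (X : metricType R)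
    (V : normedModType R[i]) (f : X -> V) : set R :=
  [set rnorm (f p.1 - f p.2) / mdist p.1 p.2 | p in [set p : X * X | p.1 != p.2]].

Definition lip_const (R : realType) (X : metricType R)
    (V : normedModType R[i]) (f : X -> V) : R := sup (lip_quotients f).

Section lip_theory.
Context {R : realType} {X : metricType R} {V : normedModType R[i]}.
Implicit Types f g : X -> V.

Lemma lip_const_ge0 f : 0 <= lip_const f.
Proof.
by apply: sup_nneg => _ [p _ <-]; rewrite divr_ge0 ?rnorm_ge0 ?mdist_ge0.
Qed.

Lemma lip_constP f x y : has_ubound (lip_quotients f) ->
  rnorm (f x - f y) <= lip_const f * mdist x y.
Proof.
move=> lf; have [->|xy] := eqVneq x y.
  by rewrite subrr rnorm0 mulr_ge0 ?lip_const_ge0 ?mdist_ge0.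
rewrite -ler_pdivrMr ?mdist_gt0//; apply: ub_le_sup => //.
by exists (x, y).
Qed.

Lemma lip_const_le f c : 0 <= c ->
  (forall x y, rnorm (f x - f y) <= c * mdist x y) -> lip_const f <= c.
Proof.
move=> c0 fc; apply: sup_le_ub0 => // _ [[x y] /= xy <-].
by rewrite ler_pdivrMr ?mdist_gt0.
Qed.

Lemma lip_ubound f c :
  (forall x y, rnorm (f x - f y) <= c * mdist x y) ->
  has_ubound (lip_quotients f).
Proof.
move=> fc; exists c => _ [[x y] /= xy <-].
by rewrite ler_pdivrMr ?mdist_gt0.
Qed.

Lemma lip_continuous f : has_ubound (lip_quotients f) -> continuous f.
Proof.
move=> lf x; apply/cvgrPdist_lt => e e0.
have eE : e = (complex.Re e)%:C by rewrite RRe_real// gtr0_real.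
have e0R : 0 < complex.Re e by rewrite -ltcR -eE.
have L1 : 0 < lip_const f + 1 by rewrite ltr_wpDl ?lip_const_ge0.
have /filterS : nbhs x (ball x (complex.Re e / (lip_const f + 1))).
  by apply: nbhsx_ballx; rewrite divr_gt0.
apply => y; rewrite ballEmdist/= ltr_pdivlMr// => xy.
rewrite rnormE eE ltcR (le_lt_trans (lip_constP x y lf))// mulrC.
by rewrite (le_lt_trans _ xy)// ler_wpM2l ?mdist_ge0// lerDl.
Qed.

Lemma lip_constD f g : has_ubound (lip_quotients f) ->
  has_ubound (lip_quotients g) ->
  lip_const (f \+ g) <= lip_const f + lip_const g.
Proof.
move=> lf lg; apply: lip_const_le => [|x y].
  by rewrite addr_ge0 ?lip_const_ge0.
rewrite opprD addrACA mulrDl (le_trans (rnormD _ _))//.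
by rewrite lerD// lip_constP.
Qed.

Lemma lip_constZ_le (a : R[i]) f : has_ubound (lip_quotients f) ->
  lip_const (a \*: f) <= rnorm (a : R[i]^o) * lip_const f.
Proof.
move=> lf; apply: lip_const_le => [|x y].
  by rewrite mulr_ge0 ?lip_const_ge0 ?rnorm_ge0.
by rewrite -scalerBr rnormZ -mulrA ler_wpM2l ?rnorm_ge0// lip_constP.
Qed.

End lip_theory.

Section lip.
Context {R : realType} (X : compactMetricType R) (K : compactType).

Definition lip_pred : {pred X -> cfun R K} :=
  mem [set f : X -> cfun R K | has_ubound (lip_quotients f)].

(* Lip(X, C(K)) *)
Record lip := Lip { lip_fun :> X -> cfun R K ; _ : lip_fun \in lip_pred }.

HB.instance Definition _ := [isSub for lip_fun].
HB.instance Definition _ := [Choice of lip by <:].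
End lip.
Arguments lip R X K : clear implicits.
Arguments lip_pred {R X K}.

Section lip_algebra.
Context {R : realType} {X : compactMetricType R} {K : compactType}.
Implicit Types f g : lip R X K.

Lemma lipP f : has_ubound (lip_quotients f).
Proof. by have := valP f => /set_mem. Qed.

Lemma lip_bounded f : sup_bounded f.
Proof. exact: (compact_sup_bounded (lip_continuous (lipP f))). Qed.

Lemma lip_subring_closed : subring_closed (@lip_pred R X K).
Proof.
split=> [|f g /set_mem lf /set_mem lg|f g /set_mem lf /set_mem lg].
- apply/mem_set; apply: (@lip_ubound _ _ _ _ 0) => x y.
  by rewrite subrr rnorm0 mul0r.
- apply/mem_set; apply: (@lip_ubound _ _ _ _ (lip_const f + lip_const g)).
  move=> x y.
  have -> : (f - g) x - (f - g) y = (f x - f y) - (g x - g y).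
    by rewrite opprD addrACA -opprD.
  rewrite (le_trans (rnormD _ _))// rnormN mulrDl.
  by rewrite lerD// lip_constP.
have bf := compact_sup_bounded (lip_continuous lf).
have bg := compact_sup_bounded (lip_continuous lg).
apply/mem_set; apply: (@lip_ubound _ _ _ _
  (lip_const f * sup_norm g + sup_norm f * lip_const g)) => x y.
have -> : (f * g) x - (f * g) y = (f x - f y) * g x + f y * (g x - g y).
  by rewrite mulrBl mulrBr addrA subrK.
rewrite (le_trans (rnormD _ _))// [leRHS]mulrDl lerD//.
  rewrite (le_trans (cfun_rnormM _ _))// mulrAC.
  by rewrite ler_pM ?rnorm_ge0 ?lip_constP ?sup_norm_ub.
rewrite (le_trans (cfun_rnormM _ _))// -mulrA.
by rewrite ler_pM ?rnorm_ge0 ?lip_constP ?sup_norm_ub.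
Qed.

HB.instance Definition _ := GRing.isSubringClosed.Build _
  (@lip_pred R X K) lip_subring_closed.
HB.instance Definition _ := GRing.SubChoice_isSubComPzRing.Build
  (X -> cfun R K) lip_pred (lip R X K) lip_subring_closed.

Lemma lip_subsemimod_closed : GRing.subsemimod_closed (@lip_pred R X K).
Proof.
split; first by split; [exact: rpred0|exact: rpredD].
move=> a f /set_mem lf; apply/mem_set.
apply: (@lip_ubound _ _ _ _ (rnorm (a : R[i]^o) * lip_const f)) => x y.
by rewrite -scalerBr rnormZ -mulrA ler_wpM2l ?rnorm_ge0// lip_constP.
Qed.
HB.instance Definition _ := GRing.SubZmodule_isSubLmodule.Build
  R[i] (X -> cfun R K) lip_pred (lip R X K) lip_subsemimod_closed.

Definition lip_norm f : R := sup_norm f + lip_const f.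

Let lip_normD f g : (lip_norm (f + g))%:C <= (lip_norm f)%:C + (lip_norm g)%:C.
Proof.
rewrite -rmorphD lecR /lip_norm [leRHS]addrACA; apply: lerD.
  exact: (sup_normD (lip_bounded f) (lip_bounded g)).
exact: (lip_constD (lipP f) (lipP g)).
Qed.

Let lip_normZ (a : R[i]) f : (lip_norm (a *: f))%:C = `|a| * (lip_norm f)%:C.
Proof.
rewrite (@rnormE _ R[i]^o a) -rmorphM/= (@homogeneous_of_le _ _ lip_norm)//.
  by move=> ?; rewrite /lip_norm addr_ge0 ?sup_norm_ge0 ?lip_const_ge0.
move=> b h; rewrite /lip_norm mulrDr; apply: lerD.
  exact: (sup_normZ_le b (lip_bounded h)).
exact: (lip_constZ_le b (lipP h)).
Qed.

Let lip_norm0_eq0 f : (lip_norm f)%:C = 0 -> f = 0.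
Proof.
move=> /(@complexI R) /eqP; rewrite /lip_norm paddr_eq0 ?sup_norm_ge0 ?lip_const_ge0//.
move=> /andP[/eqP f0 _]; apply/val_inj/funext => x /=.
by apply: sup_norm0_eq0 f0; exact: lip_bounded.
Qed.

HB.instance Definition _ := Lmodule_isNormed.Build R[i] (lip R X K)
  lip_normD lip_normZ lip_norm0_eq0.

Lemma lip_rnorm f : rnorm f = sup_norm f + lip_const f.
Proof. by []. Qed.

Lemma lipD f g x : (f + g) x = f x + g x.
Proof. by []. Qed.

Lemma lipM f g x : (f * g) x = f x * g x.
Proof. by []. Qed.

Lemma lipZ (a : R[i]) f x : (a *: f) x = a *: f x.
Proof. by []. Qed.

End lip_algebra.

Definition compact_operator (R : realType) (U V : normedModType R[i])
    (T : U -> V) : Prop :=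
  forall A : set U, bounded_set A -> precompact (T @` A).

(* Homomorphisms need not be unital. *)
Definition lip_homomorphism (R : realType) (X Y : compactMetricType R)
    (K M : compactType) (T : lip R X K -> lip R Y M) : Prop :=
  [/\ {morph T : f g / f + g}, scalable T & {morph T : f g / f * g}].

(* ereal_inf set0 = +oo, so the distance is +oo if A or B is empty. *)
Definition set_dist (R : realType) (Y : metricType R) (A B : set Y) : \bar R :=
  ereal_inf [set (mdist p.1 p.2)%:E | p in A `*` B].

(* phi and psi are defined on the subspace D only: if X or K is empty and D = set0
   they exist, although there is no function from Y * M to X or K. *)
Section canonical_form.
Context {R : realType} {X Y : compactMetricType R} {K M : compactType}.
Variables (D : set (Y * M)) (phi : D -> X) (psi : D -> K).

Definition canonical_value (T : lip R X K -> lip R Y M) : Prop :=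
  forall f, (forall p : D, T f (sval p).1 (sval p).2 = f (phi p) (psi p)) /\
    (forall y eta, ~ D (y, eta) -> T f y eta = 0).

Definition phi_lipschitz : Prop :=
  exists2 L : R, 0 <= L & forall p q : D,
    (sval p).2 = (sval q).2 -> (sval p).1 <> (sval q).1 ->
    mdist (phi p) (phi q) <= L * mdist (sval p).1 (sval q).1.

Definition psi_piecewise_cst : Prop :=
  exists2 r : R, 0 < r & forall eta : M,
    exists (n : nat) (V : 'I_n -> set Y),
    [/\ forall i, clopen (V i),
        trivIset setT V,
        [set y | D (y, eta)] = \bigcup_i V i,
        forall i (p q : D), (sval p).2 = eta -> (sval q).2 = eta ->
          V i (sval p).1 -> V i (sval q).1 -> psi p = psi q &
        forall i j, i != j -> (r%:E <= set_dist (V i) (V j))%E].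

Record has_canonical_form (T : lip R X K -> lip R Y M) : Prop := {
  canonical_clopen : clopen D ;
  canonical_phi_continuous : continuous phi ;
  canonical_psi_continuous : continuous psi ;
  canonical_valueP : canonical_value T ;
  canonical_phi_lipschitz : phi_lipschitz ;
  canonical_psi_piecewise_cst : psi_piecewise_cst
}.

Definition phi_supercontractive : Prop :=
  forall eps : R, 0 < eps -> exists2 delta : R, 0 < delta & forall p q : D,
    (sval p).2 = (sval q).2 -> 0 < mdist (sval p).1 (sval q).1 < delta ->
    mdist (phi p) (phi q) / mdist (sval p).1 (sval q).1 < eps.

Definition psi_finite_fibers : Prop :=
  forall y : Y, exists (n : nat) (Omega : 'I_n -> set M),
    [/\ forall i, clopen (Omega i),
        trivIset setT Omega,
        [set eta | D (y, eta)] = \bigcup_i Omega i &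
        forall i (p q : D), (sval p).1 = y -> (sval q).1 = y ->
          Omega i (sval p).2 -> Omega i (sval q).2 -> psi p = psi q].

End canonical_form.

(* Main.v *)
Require Import Defs.
From mathcomp Require Import all_boot all_order all_algebra.
From mathcomp Require Import ring lra complex.
From mathcomp Require Import all_classical all_reals all_analysis.

Set Implicit Arguments.
Unset Strict Implicit.
Unset Printing Implicit Defensive.

Import Order.TTheory GRing.Theory Num.Theory numFieldNormedType.Exports.

(** The conditions on phi and psi imply compactness through a criterion of
    Arzela-Ascoli type.  A family S of functions on Y * M which is bounded,
    equicontinuous, and uniformly little-Lipschitz in y (the quotients
    |g(y,eta) - g(y',eta)| / d(y,y') tend to 0 with d(y,y'), uniformly in g and
    eta) is precompact for the Lipschitz norm ([equi_little_lip_precompact]).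
    Boundedness and equicontinuity give uniform convergence along an
    ultrafilter; the third condition makes uniform convergence control the
    Lipschitz constant, because the quotients of nearby points are small anyway
    and those of distant points are dominated by the sup norm.

    To apply it to the image of a ball, note that psi does not change along Y
    at scale r and, being constant on the clopen pieces of each D_y, is locally
    constant in eta, so that psi is locally constant on D ([psi_locally_cst]).
    Hence the values of T f at two nearby points of D are values of f at two
    points of X over one and the same point of K, and their difference is at
    most ||f|| times the distance of the images under phi. Continuity of phi
    then gives equicontinuity, and supercontractivity of phi gives the
    little-Lipschitz condition; points of D and points outside D do not
    interfere, since the clopen set D is invariant under small moves along Y
    ([clopen_uniform]). This is [image_equi_little_lip].

    Conversely, suppose that T is compact.  On a compact subset of Lip(Y, C(M))
    a small sup norm forces a small Lipschitz norm ([compact_lip_small]).  For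
    two points p, q of D with the same eta, the bump of height
    rho = d_X(phi p, phi q) and slope 1 centred at phi p has sup norm rho and
    norm at most rho + 1; its image under T has the quotient rho / d_Y at the
    two points, so this quotient is small when d_Y is, and phi is
    supercontractive.  As for psi, the image of the unit ball is
    equicontinuous, whereas Urysohn functions of K, constant in x, separate any
    two values of psi(y, .) by 1; hence psi(y, .) is locally constant on the
    compact set D_y, takes finitely many values there, and its level sets are
    the required partition. *)

Local Open Scope classical_set_scope.
Local Open Scope ring_scope.
Local Open Scope complex_scope.

(** * Real-valued norms and limits along ultrafilters *)

Section rnorm_topology.
Context {R : realType} {V : normedModType R[i]}.
Implicit Types (v w : V) (A : set V).

Lemma rnorm_distC v w : rnorm (v - w) = rnorm (w - v).
Proof. by rewrite -rnormN opprB. Qed.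

Lemma rnorm_dist_triangle v u w :
  rnorm (u - w) <= rnorm (u - v) + rnorm (v - w).
Proof. by rewrite -[u in leLHS](subrK v) -addrA rnormD. Qed.

Lemma near_rnorm v (e : R) : 0 < e -> \forall w \near v, rnorm (v - w) < e.
Proof.
move=> e0; have e0C : 0 < e%:C :> R[i] by rewrite ltcR.
have /cvgrPdist_lt/(_ _ e0C) : (id : V -> V) @ v --> v by exact: cvg_id.
by apply: filterS => w /=; rewrite rnormE ltcR.
Qed.

Lemma cvg_rnorm (T : Type) (F : set_system T) (FF : Filter F) (f : T -> V) v :
  (forall e : R, 0 < e -> \forall t \near F, rnorm (v - f t) < e) ->
  f @ F --> v.
Proof.
move=> Fv; apply/cvgrPdist_lt => e e0.
have eE : e = (complex.Re e)%:C by rewrite RRe_real// gtr0_real.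
have e0R : 0 < complex.Re e by rewrite -ltcR -eE.
by apply: filterS (Fv _ e0R) => w; rewrite rnormE eE ltcR.
Qed.

Lemma rnorm_bounded_setP A : bounded_set A <->
  exists C : R, forall v, A v -> rnorm v <= C.
Proof.
split=> [[C [_ AC]]|[C AC]].
  exists (complex.Re (C + 1)) => v Av.
  have := AC (C + 1) _ v Av; rewrite /= rnormE ltrDl ltr01 => /(_ isT).
  by rewrite lecE => /andP[].
exists C%:C; split; first by rewrite complex_real.
move=> x Cx v /AC vC /=.
by rewrite rnormE (le_trans _ (ltW Cx))// lecR.
Qed.

End rnorm_topology.

(** An ultrafilter contains the preimage of each set or that of its complement,
    so a cluster point of the image filter is its limit. *)
Lemma ultra_cvg_compact (T : Type) (U : topologicalType) (F : set_system T)
    (f : T -> U) (A : set U) :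
  UltraFilter F -> compact A -> F (f @^-1` A) -> exists l : U, f @ F --> l.
Proof.
move=> FU /(_ (f @ F) _)/[apply] -[l [_ Fl]]; exists l => B lB.
have [//|FB] := in_ultra_setVsetC (f @^-1` B) FU.
by have [u []] := Fl (~` B) B FB lB.
Qed.

(** Real and imaginary parts stay in a segment, hence converge. *)
Lemma ultra_rnorm_limit (R : realType) (T : Type) (F : set_system T)
    (f : T -> R[i]^o) (C : R) :
  UltraFilter F -> (\forall t \near F, rnorm (f t) <= C) ->
  exists l : R[i]^o, forall e : R, 0 < e ->
    \forall t \near F, rnorm (l - f t) < e.
Proof.
move=> FU fC.
have lim (g : T -> R) : (\forall t \near F, `|g t| <= C) ->
    exists l : R, forall e : R, 0 < e -> \forall t \near F, `|l - g t| < e.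
  move=> gC.
  have [|l gl] := @ultra_cvg_compact _ R F g _ FU (@segment_compact R (- C) C).
    by apply: filterS gC => t /=; rewrite in_itv/= ler_norml.
  by exists l => e e0; have /cvgrPdist_lt := gl; exact.
have rnormR (z : R[i]^o) : `|complex.Re z| <= rnorm z.
  by rewrite -lecR -rnormE normc_ge_Re.
have rnormI (z : R[i]^o) : `|complex.Im z| <= rnorm z.
  rewrite -lecR -rnormE normc_def lecR -sqrtr_sqr ler_sqrt.
    by rewrite lerDr sqr_ge0.
  by rewrite addr_ge0 ?sqr_ge0.
have [|a fa] := lim (fun t => complex.Re (f t)).
  by apply: filterS fC => t; apply: le_trans.
have [|b fb] := lim (fun t => complex.Im (f t)).
  by apply: filterS fC => t; apply: le_trans.
exists (a +i* b)%C => e e0; have e20 : 0 < e / 2 by rewrite divr_gt0.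
apply: filterS2 (fa _ e20) (fb _ e20) => t {}fa {}fb.
rewrite [e]splitr (le_lt_trans _ (ltrD fa fb))//.
have -> : ((a +i* b)%C : R[i]^o) - f t = ((a - complex.Re (f t))%:C : R[i]^o)
    + (0 +i* (b - complex.Im (f t)))%C.
  by case: (f t) => c d /=; simpc.
rewrite (le_trans (rnormD _ _))// lerD//.
  by rewrite /rnorm normc_def /= expr0n addr0 sqrtr_sqr.
by rewrite /rnorm normc_def/= expr0n add0r sqrtr_sqr.
Qed.

(** * Pointwise description of Lip(X, C(K)) *)

Section lip_pointwise.
Context {R : realType} {X : compactMetricType R} {K : compactType}.
Implicit Types (f g : lip R X K).

Definition lip_eval f (p : X * K) : R[i]^o := f p.1 p.2.

Lemma lip_evalB f g p : lip_eval (f - g) p = lip_eval f p - lip_eval g p.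
Proof. by []. Qed.

Lemma lip_rnorm_ge f p : rnorm (lip_eval f p) <= rnorm f.
Proof.
rewrite lip_rnorm (le_trans (sup_norm_ub p.2 (cfun_bounded (f p.1))))//.
rewrite -cfun_rnorm (le_trans (sup_norm_ub p.1 (lip_bounded f)))//.
by rewrite lerDl lip_const_ge0.
Qed.

Lemma lip_rnorm_geB f x x' xi :
  rnorm (lip_eval f (x, xi) - lip_eval f (x', xi)) <= rnorm f * mdist x x'.
Proof.
rewrite (le_trans (sup_norm_ub xi (cfun_bounded (f x - f x'))))//.
rewrite -cfun_rnorm (le_trans (lip_constP x x' (lipP f)))//.
by rewrite ler_wpM2r ?mdist_ge0// lip_rnorm lerDr sup_norm_ge0.
Qed.

Lemma lip_rnorm_le f (a b : R) : 0 <= a -> 0 <= b ->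
  (forall p, rnorm (lip_eval f p) <= a) ->
  (forall x x' xi,
    rnorm (lip_eval f (x, xi) - lip_eval f (x', xi)) <= b * mdist x x') ->
  rnorm f <= a + b.
Proof.
move=> a0 b0 fa fb; rewrite lip_rnorm lerD//.
  apply: sup_norm_le => // x; rewrite cfun_rnorm.
  by apply: sup_norm_le => // xi; exact: (fa (x, xi)).
apply: lip_const_le => // x x'; rewrite cfun_rnorm.
by apply: sup_norm_le => [|xi]; [rewrite mulr_ge0 ?mdist_ge0|exact: fb].
Qed.

Lemma lip_intro (h : X * K -> R[i]^o) (b : R) : 0 <= b ->
  (forall x, continuous (fun xi => h (x, xi))) ->
  (forall x x' xi, rnorm (h (x, xi) - h (x', xi)) <= b * mdist x x') ->
  exists f : lip R X K, lip_eval f = h.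
Proof.
move=> b0 hc hb; pose u x : cfun R K := cfun_Sub (mem_set (hc x)).
have ub : has_ubound (lip_quotients u).
  apply: (@lip_ubound _ _ _ _ b) => x x'; rewrite cfun_rnorm.
  apply: sup_norm_le => [|xi]; first by rewrite mulr_ge0 ?mdist_ge0.
  exact: hb.
by exists (Lip (mem_set ub)); apply/funext => -[].
Qed.

End lip_pointwise.

(** * Precompactness in the Lipschitz norm *)

Lemma near_covering_setX (U V : compactType) : near_covering [set: U * V].
Proof.
apply/compact_near_coveringP; rewrite -setXTT.
by apply: compact_setX; exact: compact_space.
Qed.

Section equi_little_lip.
Context {R : realType} {Y : compactMetricType R} {M : compactType}.
Implicit Types (S : set (lip R Y M)) (g h : lip R Y M).

(** Little refers to little Lipschitz functions, those whose difference
    quotients vanish at small distances.  The weak inequalities let each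
    condition pass to pointwise limits with the same moduli. *)
Record equi_little_lip S : Prop := {
  ell_bounded : exists2 C : R, 0 <= C &
    forall g, S g -> forall p, rnorm (lip_eval g p) <= C ;
  ell_equicontinuous : forall (p : Y * M) (e : R), 0 < e ->
    \forall q \near p, forall g, S g ->
      rnorm (lip_eval g p - lip_eval g q) <= e ;
  ell_little : forall e : R, 0 < e -> exists2 delta : R, 0 < delta &
    forall g, S g -> forall y y' eta, mdist y y' < delta ->
      rnorm (lip_eval g (y, eta) - lip_eval g (y', eta)) <= e * mdist y y'
}.

Lemma closure_lip_approx S g (e : R) : closure S g -> 0 < e ->
  exists2 h, S h & forall p, rnorm (lip_eval g p - lip_eval h p) < e.
Proof.
move=> gS /(near_rnorm g)/gS[h [Sh gh]]; exists h => // p.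
by rewrite -lip_evalB (le_lt_trans (lip_rnorm_ge _ _)).
Qed.

(** Precompactness of S is compactness of its closure, to which the conditions
    therefore have to be transferred. *)
Lemma equi_little_lip_closure S :
  equi_little_lip S -> equi_little_lip (closure S).
Proof.
have closureB p q (c : R) :
    (forall g, S g -> rnorm (lip_eval g p - lip_eval g q) <= c) ->
    forall g, closure S g -> rnorm (lip_eval g p - lip_eval g q) <= c.
  move=> Sc g gS; apply/ler_addgt0Pl => e e0.
  have [h /Sc hc gh] := closure_lip_approx gS (divr_gt0 e0 (ltr0n R 2)).
  have -> : e + c = e / 2 + (c + e / 2) by lra.
  rewrite (le_trans (rnorm_dist_triangle (lip_eval h p) _ _))//.
  rewrite lerD ?(ltW (gh _))//.
  rewrite (le_trans (rnorm_dist_triangle (lip_eval h q) _ _))// lerD//.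
  by rewrite rnorm_distC ltW.
move=> [[C C0 SC] Se Ss]; split.
- exists C => // g gS p; apply/ler_addgt0Pl => e e0.
  have [h /SC hc gh] := closure_lip_approx gS e0.
  rewrite -(subrK (lip_eval h p) (lip_eval g p)) (le_trans (rnormD _ _))//.
  by rewrite lerD// ltW.
- by move=> p e e0; apply: filterS (Se p e e0) => q; exact: closureB.
- move=> e /Ss[d d0 Sd]; exists d => // g gS y y' eta yd.
  by apply: closureB gS => h Sh; exact: Sd.
Qed.

(** The limit of an ultrafilter F on S is first taken pointwise.  It inherits
    the three conditions, hence is Lipschitz and continuous, and F tends to it
    uniformly because Y * M is compact.  The little-Lipschitz condition then
    upgrades uniform convergence to convergence of Lipschitz constants. *)
Lemma equi_little_lip_compact S : equi_little_lip S -> closed S -> compact S.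
Proof.
move=> [[C C0 SC] Se Ss] Scl; rewrite compact_ultra => F FU FS.
have /choice[G FG] : forall p, exists l : R[i]^o, forall e : R, 0 < e ->
    \forall g \near F, rnorm (l - lip_eval g p) < e.
  move=> p; apply: (@ultra_rnorm_limit _ _ F _ C).
  by apply: filterS FS => g Sg; exact: SC.
have GB p q (c : R) :
    (forall g, S g -> rnorm (lip_eval g p - lip_eval g q) <= c) ->
    rnorm (G p - G q) <= c.
  move=> Sc; apply/ler_addgt0Pl => e e0.
  have e20 : 0 < e / 2 by rewrite divr_gt0.
  have [g [/Sc gc [gp gq]]] :=
    filter_ex (filterI FS (filterI (FG p _ e20) (FG q _ e20))).
  have -> : e + c = e / 2 + (c + e / 2) by lra.
  rewrite (le_trans (rnorm_dist_triangle (lip_eval g p) _ _))//.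
  rewrite lerD ?(ltW gp)//.
  rewrite (le_trans (rnorm_dist_triangle (lip_eval g q) _ _))// lerD//.
  by rewrite rnorm_distC ltW.
have GC p : rnorm (G p) <= C.
  apply/ler_addgt0Pl => e e0.
  have [g [/SC gC gp]] := filter_ex (filterI FS (FG p _ e0)).
  by rewrite -(subrK (lip_eval g p) (G p)) (le_trans (rnormD _ _))// lerD// ltW.
have Ge p (e : R) : 0 < e -> \forall q \near p, rnorm (G p - G q) <= e.
  by move=> e0; apply: filterS (Se p e e0) => q Sq; exact: GB.
have Gs (e : R) : 0 < e -> exists2 delta : R, 0 < delta &
    forall y y' eta, mdist y y' < delta ->
      rnorm (G (y, eta) - G (y', eta)) <= e * mdist y y'.
  move=> /Ss[d d0 Sd]; exists d => // y y' eta yd.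
  by apply: GB => g Sg /=; exact: Sd.
have FGu (e : R) : 0 < e ->
    \forall g \near F, forall p, rnorm (G p - lip_eval g p) <= e.
  move=> e0.
  have e3 : 0 < e / 3 by rewrite divr_gt0.
  pose close g p := rnorm (G p - lip_eval g p) <= e.
  suff : forall p, [set: Y * M] p -> \forall q \near p & g \near F, close g q.
    move=> /(@near_covering_setX Y M _ _ close _).
    by apply: filterS => g /= gp p; exact: gp.
  move=> p _.
  exists ([set q | rnorm (G p - G q) <= e / 3 /\ forall g, S g ->
        rnorm (lip_eval g p - lip_eval g q) <= e / 3],
     [set g | S g /\ rnorm (G p - lip_eval g p) < e / 3]) => /=.
    split; first by apply: filterI; [exact: Ge|exact: Se].
    by apply: filterI => //; exact: FG.
  rewrite /close => -[q g] /= [[Gpq gpq] [Sg Gg]].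
  rewrite (le_trans (rnorm_dist_triangle (G p) _ _))//.
  have -> : e = e / 3 + (e / 3 + e / 3) by lra.
  rewrite lerD//; first by rewrite rnorm_distC.
  rewrite (le_trans (rnorm_dist_triangle (lip_eval g p) _ _))//.
  rewrite lerD ?(ltW Gg)//.
  exact: gpq.
have far y y' eta (c d : R) (h : Y * M -> R[i]^o) : 0 < d -> d <= mdist y y' ->
    (forall p, rnorm (h p) <= c) ->
    rnorm (h (y, eta) - h (y', eta)) <= 2 * c / d * mdist y y'.
  move=> d0 dy hc; rewrite (le_trans (rnormD _ _))// rnormN.
  rewrite (le_trans (lerD (hc _) (hc _)))//.
  rewrite -mulrA [X in _ * X]mulrC mulrDl mul1r ler_peMr//.
    by rewrite addr_ge0// (le_trans (rnorm_ge0 (h (y, eta)))).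
  by rewrite ler_pdivlMr// mul1r.
have [d1 d10 Gd1] := Gs 1 ltr01.
have [g gG] : exists g : lip R Y M, lip_eval g = G.
  apply: (@lip_intro _ _ _ G (1 + 2 * C / d1)).
  - by rewrite addr_ge0// divr_ge0 ?(ltW d10)// mulr_ge0.
  - move=> y eta; apply: cvg_rnorm => e e0.
    have [[A B] /= [yA etaB] AB] := Ge (y, eta) _ (divr_gt0 e0 (ltr0n R 2)).
    apply: filterS etaB => eta' B'; rewrite (le_lt_trans (AB (y, eta') _))//=.
      by split => //=; exact: nbhs_singleton.
    by rewrite ltr_pdivrMr// ltr_pMr// ltr1n.
  - move=> y y' eta; rewrite mulrDl mul1r.
    have [yd|yd] := ltP (mdist y y') d1.
      rewrite (le_trans (Gd1 _ _ eta yd))// mul1r lerDl.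
      by rewrite mulr_ge0 ?mdist_ge0// divr_ge0 ?(ltW d10)// mulr_ge0.
    by rewrite (le_trans (far _ _ _ _ _ _ d10 yd GC))// lerDr mdist_ge0.
have Fg : F --> g.
  apply: (@cvg_rnorm _ _ _ F _ id) => e e0.
  have e4 : 0 < e / 4 by rewrite divr_gt0.
  have e8 : 0 < e / 8 by rewrite divr_gt0.
  (* Below distance m the quotients of G - h are at most e / 4 whatever h in S;
     above m they are at most 2 t / m, which is e / 4 for t = e m / 8. *)
  have [d d0 Sd] := Ss _ e8.
  have [d' d'0 Gd] := Gs _ e8.
  pose m := Num.min d d'.
  have m0 : 0 < m by rewrite lt_min d0.
  have t0 : 0 < Num.min (e / 4) (e * m / 8).
    by rewrite lt_min e4 divr_gt0// mulr_gt0.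
  apply: filterS2 FS (FGu _ t0) => h Sh Gh.
  apply: (@le_lt_trans _ _ (e / 4 + e / 4)); last by lra.
  have ghE p : lip_eval (g - h) p = G p - lip_eval h p by rewrite lip_evalB gG.
  apply: lip_rnorm_le; rewrite ?(ltW e4)//.
    by move=> p; rewrite ghE (le_trans (Gh p))// ge_min lexx.
  move=> y y' eta; have [|my] := ltP (mdist y y') m.
    rewrite lt_min => /andP[yd yd']; rewrite !ghE opprD addrACA -opprD.
    have -> : e / 4 = e / 8 + e / 8 by lra.
    by rewrite (le_trans (rnormD _ _))// rnormN mulrDl lerD ?Gd ?Sd.
  have c8 p : rnorm (lip_eval (g - h) p) <= e * m / 8.
    by rewrite ghE (le_trans (Gh p))// ge_min lexx orbT.
  rewrite (le_trans (far _ _ _ _ _ _ m0 my c8))//.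
  suff -> : 2 * (e * m / 8) / m = e / 4 by [].
  by field; rewrite gt_eqF.
exists g; split=> //.
by apply: Scl => B /Fg FB; exact: (filter_ex (filterI FS FB)).
Qed.

Lemma equi_little_lip_precompact S : equi_little_lip S -> precompact S.
Proof.
move=> /equi_little_lip_closure Sl; rewrite precompactE.
by apply: equi_little_lip_compact => //; exact: closed_closure.
Qed.

End equi_little_lip.

(** * From the conditions on phi and psi to compactness *)

(** A neighbourhood of each point of the clopen set contains a product with a
    ball of Y, and compactness makes the radius uniform. *)
Lemma clopen_uniform (R : realType) (Y : compactMetricType R) (M : compactType)
    (D : set (Y * M)) : clopen D ->
  exists2 r : R, 0 < r & forall y y' eta, mdist y y' < r ->
    D (y, eta) -> D (y', eta).
Proof.
move=> [oD cD].
have /(@near_covering_setX Y M _ _ _ _) : forall p, [set: Y * M] p ->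
    \forall q \near p & r \near (0 : R)^'+, forall y', mdist q.1 y' < r ->
      D q -> D (y', q.2).
  move=> p _; have [Dp|nDp] := pselect (D p); last first.
    exists (~` D, setT) => /=; last by move=> [q r] [].
    split; last exact: filterT.
    by apply: open_nbhs_nbhs; split=> //; exact: closed_openC.
  have /open_nbhs_nbhs[[A B] /= [pA pB] ABD] : open_nbhs p D by [].
  have /nbhs_ballP[e /= e0 eA] := pA.
  have e20 : 0 < e / 2 by rewrite divr_gt0.
  exists (ball p.1 (e / 2) `*` B, [set r | r < e / 2]) => /=.
    split.
      exists (ball p.1 (e / 2), B) => //; split => //.
      exact: nbhsx_ballx.
    by apply: nbhs_right_lt.
  move=> [[y eta] r] /= [[py Beta] re] y' yy' _; apply: ABD; split => //=.
  apply: eA; rewrite [e]splitr; apply: ball_triangle py _.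
  by rewrite ballEmdist /= (lt_trans yy').
move=> H; have := filter_ex (filterI H (nbhs_right_gt (0:R))).
move=> [r [rD r0]]; exists r => // y y' eta yy'.
exact: (rD (y, eta) I).
Qed.

(** Continuity on a subspace, read in the ambient space: points near p may lie
    outside D, hence the quantification over the q' of D that sit over q. *)
Lemma continuous_set_type (U V : topologicalType) (D : set U) (f : D -> V)
    (p : D) (B : set V) : continuous f -> nbhs (f p) B ->
  \forall q \near sval p, forall q' : D, sval q' = q -> B (f q').
Proof.
move=> fc /fc; case=> W [] [V' oV' <-] V'p V'B.
apply: filterS (open_nbhs_nbhs (conj oV' V'p)) => q V'q q' q'q.
by apply: V'B; rewrite -q'q in V'q.
Qed.

Section canonical.
Context {R : realType} {X Y : compactMetricType R} {K M : compactType}.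
Context {D : set (Y * M)} {phi : D -> X} {psi : D -> K}.
Context {T : lip R X K -> lip R Y M}.

(** Points of one fibre at distance less than r lie in the same piece V_i. *)
Lemma psi_cst_along_Y : psi_piecewise_cst psi ->
  exists2 r : R, 0 < r & forall p q : D, (sval p).2 = (sval q).2 ->
    mdist (sval p).1 (sval q).1 < r -> psi p = psi q.
Proof.
move=> [r r0 Dr]; exists r => // p q pq rpq.
have [n [V [_ _ DV psiV dV]]] := Dr (sval p).2.
have in_V (u : D) : (sval u).2 = (sval p).2 -> exists i, V i (sval u).1.
  move=> up; have : [set y | D (y, (sval p).2)] (sval u).1.
    by rewrite /= -up -surjective_pairing; exact: set_mem (valP u).
  by rewrite DV => -[i _ Vi]; exists i.
have [[i Vi] [j Vj]] := (in_V p erefl, in_V q (esym pq)).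
have [ij|/dV rij] := eqVneq i j; first by apply: psiV Vi _; rewrite // ij.
have : (set_dist (V i) (V j) <= (mdist (sval p).1 (sval q).1)%:E)%E.
  by apply: ereal_inf_lbound; exists ((sval p).1, (sval q).1).
by move=> /(le_trans rij); rewrite lee_fin leNgt rpq.
Qed.

(** Move from (y, eta) to (y', eta') in two steps: first along M inside a piece
    of D_y, then along Y at scale r.  The corner (y, eta') belongs to D, as the
    piece is contained in D_y. *)
Lemma psi_locally_cst : clopen D -> psi_piecewise_cst psi ->
  psi_finite_fibers psi -> forall p : D,
  \forall q \near sval p, forall q' : D, sval q' = q -> psi q' = psi p.
Proof.
move=> [oD _] /psi_cst_along_Y[r r0 psir] fin [[y eta] Dp].
have [n [Om [clOm _ DOm psiOm]]] := fin y.
have : [set eta' | D (y, eta')] eta by exact: set_mem Dp.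
rewrite DOm => -[i _ Oi]; exists (ball y r, Om i) => /=.
  split; first exact: nbhsx_ballx.
  by apply: open_nbhs_nbhs; split => //; case: (clOm i).
move=> q [/= yq Oq] [[y' eta'] Dq'] /= qE; rewrite -qE /= in yq Oq.
have Dyq : (y, eta') \in D.
  by apply/mem_set; have : (\bigcup_i Om i) eta' by [exists i]; rewrite -DOm.
transitivity (psi (exist _ (y, eta') Dyq)).
  by apply: psir => //=; rewrite metric_sym; rewrite ballEmdist in yq.
by apply: (psiOm i).
Qed.

(** When psi p = psi q, the values of T f at p and q are values of f at two
    points of X over the same point of K, so that
    |T f p - T f q| <= C d_X(phi p, phi q).  Continuity of phi turns this into
    equicontinuity, and supercontractivity turns it into the little-Lipschitz
    condition. *)
Lemma image_equi_little_lip (A : set (lip R X K)) (C : R) :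
  has_canonical_form phi psi T ->
  phi_supercontractive phi -> psi_finite_fibers psi ->
  (forall f, A f -> rnorm f <= C) -> equi_little_lip (T @` A).
Proof.
move=> can con fin AC.
(* C serves as a denominator below. *)
wlog C1 : C AC / 1 <= C.
  move=> /(_ (Num.max C 1)); apply; last by rewrite le_max lexx orbT.
  by move=> f /AC fC; rewrite le_max fC.
have C0 : 0 < C by rewrite (lt_le_trans ltr01).
have [[oD cD] phic _ TE _ psiV] := can.
have TD f (p : D) : lip_eval (T f) (sval p) = lip_eval f (phi p, psi p).
  by have [Tf _] := TE f; exact: Tf.
have TnD f p : ~ D p -> lip_eval (T f) p = 0.
  by case: p => y eta; have [_] := TE f; exact.
have TfB f (p q : D) : A f -> psi p = psi q ->
    rnorm (lip_eval (T f) (sval p) - lip_eval (T f) (sval q)) <=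
    C * mdist (phi p) (phi q).
  move=> /AC fC pq; rewrite !TD pq (le_trans (lip_rnorm_geB _ _ _ _))//.
  by rewrite ler_wpM2r// mdist_ge0.
split.
- exists C => [|_ [f Af <-] p]; first exact: ltW.
  have [Dp|/TnD->] := pselect (D p); last by rewrite rnorm0 ltW.
  rewrite (TD f (exist _ p (mem_set Dp))).
  by rewrite (le_trans (lip_rnorm_ge _ _)) ?AC.
- move=> p e e0; have [Dp|nDp] := pselect (D p); last first.
    have : nbhs p (~` D).
      by apply: open_nbhs_nbhs; split => //; exact: closed_openC.
    apply: filterS => q nDq _ [f _ <-].
    by rewrite !TnD// subrr rnorm0 ltW.
  pose p' : D := exist _ p (mem_set Dp).
  have : nbhs (phi p') (ball (phi p') (e / C)).
    by apply: nbhsx_ballx; rewrite divr_gt0.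
  move=> /(continuous_set_type phic).
  apply: filterS3 (psi_locally_cst (conj oD cD) psiV fin p')
     (open_nbhs_nbhs (conj oD Dp)) => q psiq Dq phiq _ [f Af <-].
  pose q' : D := exist _ q (mem_set Dq).
  rewrite (le_trans (TfB f p' q' Af _))//; first by rewrite (psiq q').
  by have := phiq q' erefl; rewrite ballEmdist /= ltr_pdivlMr// mulrC => /ltW.
- move=> e e0; have [d d0 con'] := con (e / C) (divr_gt0 e0 C0).
  have [r r0 psir] := psi_cst_along_Y psiV.
  have [s s0 Ds] := clopen_uniform (conj oD cD).
  exists (Num.min d (Num.min r s)); first by rewrite !lt_min d0 r0.
  move=> _ [f Af <-] y y' eta; rewrite !lt_min => /and3P[yd yr ys].
  have [->|yy'] := eqVneq y y'.
    by rewrite subrr rnorm0 mulr_ge0 ?mdist_ge0 ?ltW.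
  have [Dy|nDy] := pselect (D (y, eta)); last first.
    have nDy' : ~ D (y', eta).
      by move=> /(Ds y' y); apply: contra_not nDy; apply; rewrite metric_sym.
    by rewrite !TnD// subrr rnorm0 mulr_ge0 ?mdist_ge0 ?ltW.
  pose p : D := exist _ (y, eta) (mem_set Dy).
  pose q : D := exist _ (y', eta) (mem_set (Ds y y' eta ys Dy)).
  rewrite (le_trans (TfB f p q Af _))//; first exact: psir.
  have yy0 : 0 < mdist y y' by rewrite mdist_gt0.
  have := con' p q erefl; rewrite /= yy0 yd => /(_ isT).
  by rewrite ltr_pdivrMr// => /ltW; rewrite mulrAC ler_pdivlMr// mulrC.
Qed.

Lemma supercontractive_compact_operator : has_canonical_form phi psi T ->
  phi_supercontractive phi -> psi_finite_fibers psi -> compact_operator T.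
Proof.
move=> can con fin A /rnorm_bounded_setP[C AC].
by apply: equi_little_lip_precompact; exact: image_equi_little_lip AC.
Qed.

End canonical.

(** * From compactness to the conditions on phi and psi *)

(** Otherwise the complements of the preimages of finite sets generate a proper
    filter on A; at a cluster point u, the complement of the preimage of the
    single value f u contradicts local constancy. *)
Lemma compact_locally_cst_finite (U : topologicalType) (V : Type) (A : set U)
    (f : U -> V) : compact A ->
  (forall u, A u -> \forall v \near u, A v -> f v = f u) -> finite_set (f @` A).
Proof.
move=> cA fcst; apply: contrapT => infA.
pose F := filter_from (@finite_set V) (fun s => A `\` f @^-1` s).
have FF : ProperFilter F.
  apply: filter_from_proper; last first.
    move=> s sfin; apply: contrapT => /set0P/negP; rewrite negbK => /eqP As0.
    apply: infA; apply: sub_finite_set sfin => _ [u Au <-].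
    by apply: contrapT => nsu; have : (A `\` f @^-1` s) u by []; rewrite As0.
  apply: filter_from_filter; first by exists set0; exact: finite_set0.
  move=> s t sfin tfin; exists (s `|` t); first by rewrite finite_setU.
  by move=> u [Au /not_orP[su tu]].
have [|u [Au Fu]] := cA F FF.
  by exists set0; [exact: finite_set0|move=> u []].
have [|v [[Av nfv] fv]] := Fu (A `\` f @^-1` [set f u]) _ _ (fcst u Au).
  by exists [set f u] => //; exact: finite_set1.
by apply: nfv; exact: fv.
Qed.

Section test_functions.
Context {R : realType} {X : compactMetricType R} {K : compactType}.

Lemma rnorm_real_complex (a : R) : rnorm (a%:C : R[i]^o) = `|a|.
Proof. by rewrite /rnorm normc_def /= expr0n addr0 sqrtr_sqr. Qed.

Lemma real_complexB (a b : R) : (a%:C : R[i]^o) - b%:C = (a - b)%:C.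
Proof. by rewrite rmorphB. Qed.

Lemma lip_bump (x0 : X) (rho : R) : 0 <= rho -> exists f : lip R X K,
  lip_eval f = (fun p => (Num.max 0 (rho - mdist p.1 x0))%:C) /\
  rnorm f <= rho + 1.
Proof.
move=> rho0; pose h (p : X * K) : R[i]^o := (Num.max 0 (rho - mdist p.1 x0))%:C.
have hB x x' xi : rnorm (h (x, xi) - h (x', xi)) <= 1 * mdist x x'.
  rewrite real_complexB rnorm_real_complex mul1r.
  have d0 := mdist_ge0 x x'.
  have := metric_triangle x x' x0; have := metric_triangle x' x x0.
  rewrite (metric_sym x' x) ler_norml !maxEle /=.
  by case: ifP; case: ifP => /= *; lra.
have hc x : continuous (fun xi => h (x, xi)) by move=> xi; exact: cvg_cst.
have [f fh] := lip_intro ler01 hc hB.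
exists f; split=> //; apply: lip_rnorm_le => //; rewrite fh// => p.
rewrite rnorm_real_complex ger0_norm; last by rewrite le_max lexx.
by rewrite ge_max rho0 gerBl mdist_ge0.
Qed.

Lemma lip_of_cfun (u : K -> R) : continuous u -> (forall xi, `|u xi| <= 1) ->
  exists f : lip R X K, lip_eval f = (fun p => (u p.2)%:C) /\ rnorm f <= 1.
Proof.
move=> uc u1; pose h (p : X * K) : R[i]^o := (u p.2)%:C.
have hc x : continuous (fun xi => h (x, xi)).
  move=> xi; apply: cvg_rnorm => e e0.
  have /cvgrPdist_lt/(_ _ e0) := uc xi.
  by apply: filterS => xi'; rewrite real_complexB rnorm_real_complex.
have hB x x' xi : rnorm (h (x, xi) - h (x', xi)) <= 0 * mdist x x'.
  by rewrite subrr rnorm0 mul0r.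
have [f fh] := lip_intro (lexx 0) hc hB.
exists f; split=> //; rewrite -[leRHS]addr0.
by apply: lip_rnorm_le; rewrite ?fh// => p; rewrite rnorm_real_complex.
Qed.

End test_functions.

(** A sup norm tending to 0 cannot keep a Lipschitz norm at least e on a compact
    set: a nonzero g has some value of modulus 2 a, hence sup norm more than a
    in a neighbourhood, and near g = 0 the Lipschitz norm itself is small. *)
Lemma compact_lip_small (R : realType) (Y : compactMetricType R)
    (M : compactType) (S : set (lip R Y M)) : compact S ->
  forall e : R, 0 < e -> exists2 t : R, 0 < t & forall g, S g ->
    (forall p, rnorm (lip_eval g p) <= t) -> rnorm g < e.
Proof.
move=> /compact_near_coveringP cS e e0.
pose small t (g : lip R Y M) :=
  (forall p, rnorm (lip_eval g p) <= t) -> rnorm g < e.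
have locally_small g : S g -> \forall h \near g & t \near (0 : R)^'+, small t h.
  have [[p gp] _|/forallNP g0 _] :=
    pselect (exists p, 0 < rnorm (lip_eval g p)).
    pose a := rnorm (lip_eval g p) / 2.
    have a0 : 0 < a by rewrite divr_gt0.
    exists ([set h | rnorm (g - h) < a], [set t | t < a]) => /=.
      by split; [exact: (near_rnorm g a0)|exact: nbhs_right_lt].
    move=> [h t] /= [gh ta] /(_ p) hpt; exfalso.
    have := rnormD (lip_eval (g - h) p) (lip_eval h p).
    rewrite lip_evalB subrK leNgt => /negP; apply.
    rewrite [ltRHS]splitr ltrD ?(le_lt_trans hpt)//.
    by rewrite -lip_evalB (le_lt_trans (lip_rnorm_ge _ _)).
  have gp0 p : lip_eval g p = 0.
    apply: rnorm0_eq0; apply/eqP.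
    by rewrite eq_le rnorm_ge0 andbT leNgt; exact/negP/g0.
  have {}g0 : g = 0.
    apply: rnorm0_eq0; apply/eqP; rewrite eq_le rnorm_ge0 andbT -[leRHS]addr0.
    apply: lip_rnorm_le => // [p|x x' xi]; first by rewrite gp0 rnorm0.
    by rewrite !gp0 subrr rnorm0 mul0r.
  exists ([set h | rnorm (g - h) < e], setT) => /=.
    by split; [exact: (near_rnorm g e0)|exact: filterT].
  by move=> [h t] /= [+ _] _; rewrite g0 sub0r rnormN.
have near_small : \forall t \near (0 : R)^'+, S `<=` small t by exact: cS.
have [t [t0 tS]] := filter_ex (filterI (nbhs_right_gt (0 : R)) near_small).
by exists t.
Qed.

Section necessity.
Context {R : realType} {X Y : compactMetricType R} {K M : compactType}.
Context {D : set (Y * M)} {phi : D -> X} {psi : D -> K}.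
Context {T : lip R X K -> lip R Y M}.
Context (can : has_canonical_form phi psi T) (cptT : compact_operator T).

Let TD f (p : D) : lip_eval (T f) (sval p) = lip_eval f (phi p, psi p).
Proof. by have [Tf _] := canonical_valueP can f; exact: Tf. Qed.

Let TnD f p : ~ D p -> lip_eval (T f) p = 0.
Proof. by case: p => y eta; have [_] := canonical_valueP can f; exact. Qed.

Let cptB (C : R) : compact (closure (T @` [set f | rnorm f <= C])).
Proof.
by rewrite -precompactE; apply: cptT; apply/rnorm_bounded_setP; exists C.
Qed.

(** The test function is the bump of height rho = d_X(phi p, phi q) at phi p:
    T f is at most rho in modulus, takes the values rho at p and 0 at q, and
    [compact_lip_small] bounds its quotient rho / d_Y. *)
Lemma compact_phi_supercontractive : phi_supercontractive phi.
Proof.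
have [L L0 phiL] := canonical_phi_lipschitz can.
move=> e /(compact_lip_small (@cptB (L + 1)))[t t0 St].
(* At distance d_Y below 1 the bumps stay in the ball of radius L + 1, and
   below t / (L + 1) their height, at most L d_Y, does not exceed t. *)
exists (Num.min 1 (t / (L + 1))) => [|p q pq].
  by rewrite lt_min ltr01 divr_gt0// ltr_wpDl.
rewrite lt_min => /and3P[d0 d1 dt].
have pq1 : (sval p).1 <> (sval q).1.
  by move=> pqE; move: d0; rewrite pqE mdistxx ltxx.
have phid := phiL p q pq pq1.
pose rho := mdist (phi p) (phi q).
have rho0 : 0 <= rho by exact: mdist_ge0.
have rhot : rho <= t.
  rewrite (le_trans phid)//; move: dt; rewrite ltr_pdivlMr ?ltr_wpDl// => dt.
  rewrite (le_trans _ (ltW dt))// mulrC ler_wpM2l ?(ltW d0)//.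
  by rewrite lerDl.
have [f [fE f1]] := @lip_bump _ X K (phi p) _ rho0.
have fL : rnorm f <= L + 1.
  rewrite (le_trans f1)// lerD2r (le_trans phid)// ler_piMr// ltW//.
have Tf : rnorm (T f) < e.
  apply: St => [|u]; first by apply: subset_closure; exists f.
  have [Du|/TnD ->] := pselect (D u); last by rewrite rnorm0 ltW.
  rewrite (TD f (exist _ u (mem_set Du))) fE rnorm_real_complex.
  rewrite ger0_norm ?le_max ?lexx//.
  by rewrite ge_max (ltW t0)/= (le_trans _ rhot)// gerBl mdist_ge0.
rewrite ltr_pdivrMr//.
apply: (@le_lt_trans _ _ (rnorm (T f) * mdist (sval p).1 (sval q).1)).
  apply: le_trans (lip_rnorm_geB (T f) _ _ (sval p).2).
  rewrite -surjective_pairing pq -surjective_pairing !TD fE /=.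
  rewrite mdistxx subr0 (metric_sym (phi q)) subrr maxxx max_r//.
  by rewrite subr0 rnorm_real_complex ler_norm.
by rewrite ltr_pM2r.
Qed.

(** Equicontinuity at p of the image of the unit ball gives a neighbourhood of
    the M-coordinate of p on which no T f varies by 1, whereas T f varies by
    exactly 1 between p and q when f is a Urysohn function separating psi p
    from psi q. *)
Lemma compact_psi_locally_cst (hK : hausdorff_space K) (p : D) :
  \forall eta \near (sval p).2, forall q : D, sval q = ((sval p).1, eta) ->
    psi q = psi p.
Proof.
have /compact_near_coveringP cS := @cptB 1.
pose close eta (h : lip R Y M) :=
  rnorm (lip_eval h ((sval p).1, eta) - lip_eval h (sval p)) < 1.
have : forall g, closure (T @` [set f | rnorm f <= 1]) g ->
    \forall h \near g & eta \near (sval p).2, close eta h.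
  move=> g _.
  have e4 : 0 < 1 / 4 :> R by rewrite divr_gt0.
  exists ([set h | rnorm (g - h) < 1 / 4], [set eta |
    rnorm (lip_eval g (sval p) - lip_eval g ((sval p).1, eta)) < 1 / 4]) => /=.
    split; first exact: (near_rnorm g e4).
    have := near_rnorm (g (sval p).1 (sval p).2 : R[i]^o) e4.
    exact: (@cfun_continuous _ _ (g (sval p).1)).
  rewrite /close => -[h eta] /= [gh geta].
  have ghu u : rnorm (lip_eval g u - lip_eval h u) < 1 / 4.
    by rewrite -lip_evalB (le_lt_trans (lip_rnorm_ge _ _)).
  rewrite (le_lt_trans
    (rnorm_dist_triangle (lip_eval g ((sval p).1, eta)) _ _))//.
  rewrite (@lt_trans _ _ (1 / 4 + (1 / 4 + 1 / 4)))//; last by lra.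
  rewrite ltrD//; first by rewrite rnorm_distC.
  rewrite (le_lt_trans (rnorm_dist_triangle (lip_eval g (sval p)) _ _))//.
  rewrite ltrD//.
  by rewrite rnorm_distC.
move=> /(cS _ _ close _); apply: filterS => eta Seta q qE.
apply: contrapT => pq.
have K1 (xi : K) : closed [set xi].
  exact: (accessible_closed_set1 (hausdorff_accessible hK)).
have nK : normal_space K by apply: compact_normal => //; exact: compact_space.
have /(@uniform_separatorP _ R)[u [uc u01 u0 u1]] :
    uniform_separator [set psi q] [set psi p].
  apply: (normal_separatorP (R := R)).1 => //.
  by rewrite -subset0 => xi /= [-> /pq].
have [|f [fE f1]] := @lip_of_cfun _ X K u uc.
  move=> xi; have /u01 : range u (u xi) by exists xi.
  by rewrite /= in_itv/= => /andP[? ?]; rewrite ger0_norm.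
have /Seta : closure (T @` [set f | rnorm f <= 1]) (T f).
  by apply: subset_closure; exists f.
rewrite /close -qE (TD f q) (TD f p) fE /=.
rewrite (u0 (u (psi q))); last by exists (psi q).
rewrite (u1 (u (psi p))); last by exists (psi p).
by rewrite real_complexB rnorm_real_complex sub0r normrN normr1 ltxx.
Qed.

(** The sets Omega_i are the level sets of psi(y, .) for its finitely many
    values: local constancy makes any union of level sets open, hence each of
    them clopen. *)
Lemma compact_psi_finite_fibers (hK : hausdorff_space K) :
  psi_finite_fibers psi.
Proof.
move=> y; have [oD cD] := canonical_clopen can.
pose Dy : set M := [set eta | D (y, eta)].
have sect_cts : continuous (fun eta : M => (y, eta)).
  by move=> eta; apply: cvg_pair; [exact: cvg_cst|exact: cvg_id].
have oDy : open Dy.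
  apply: (@open_comp _ _ (fun eta : M => (y, eta))) oD => eta _.
  exact: sect_cts.
have cDy : closed Dy.
  apply: (@preimage_closed _ _ (fun eta : M => (y, eta))) cD => eta _.
  exact: sect_cts.
have cptDy : compact Dy.
  by apply: (subclosed_compact cDy compact_space).
(* psi is defined on D only; v extends psi(y, .) to M by None. *)
pose v eta : option K := if pselect (D (y, eta)) is left Deta
  then Some (psi (exist _ (y, eta) (mem_set Deta))) else None.
have vE (q : D) : (sval q).1 = y -> v (sval q).2 = Some (psi q).
  case: q => -[y' eta] Dq /= y'y; subst y'; rewrite /v.
  case: pselect => [Deta|/(_ (set_mem Dq))//].
  by congr (Some (psi _)); exact: eq_sig_hprop.
have vcst eta : Dy eta -> \forall eta' \near eta, Dy eta' -> v eta' = v eta.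
  move=> Deta; pose p : D := exist _ (y, eta) (mem_set Deta).
  apply: filterS (compact_psi_locally_cst hK p) => eta' psieta' Deta'.
  pose q : D := exist _ (y, eta') (mem_set Deta').
  by rewrite (vE q)// (vE p)// (psieta' q).
have level_open B : open (Dy `&` v @^-1` B).
  rewrite openE => eta [Deta Beta].
  apply: filterS2 (open_nbhs_nbhs (conj oDy Deta)) (vcst _ Deta) => eta' Deta'.
  by move=> /(_ Deta') /= vv; split=> //=; rewrite vv.
have level_clopen B : clopen (Dy `&` v @^-1` B).
  split=> //; rewrite -openC setCI.
  have -> : ~` Dy `|` ~` (v @^-1` B) = ~` Dy `|` (Dy `&` v @^-1` (~` B)).
    apply/seteqP; split=> eta /=; last by move=> [|[_]]; [left|right].
    by have [Deta [//|Beta]|] := pselect (Dy eta); [right|left].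
  by apply: openU => //; exact: closed_openC.
have /finite_seqP[s0 vs0] := compact_locally_cst_finite cptDy vcst.
pose s := undup s0.
exists (size s), (fun i => Dy `&` v @^-1` [set nth None s i]); split=> //.
- move=> i j _ _ [eta [[_ /= vi] [_ /= vj]]]; apply/val_inj/eqP => /=.
  by rewrite -(nth_uniq None (ltn_ord i) (ltn_ord j) (undup_uniq _)) -vi -vj.
- apply/seteqP; split=> [eta Deta|eta [i _ []//]].
  have : (v @` Dy) (v eta) by exists eta.
  rewrite vs0 /= -mem_undup -/s => vs.
  have vs_lt : (index (v eta) s < size s)%N by rewrite index_mem.
  by exists (Ordinal vs_lt) => //; split=> //=; rewrite nth_index.
- by move=> i p q py qy [_ /= +] [_ /=]; rewrite !vE// => <- [->].
Qed.

End necessity.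

Theorem theorem2 (R : realType) (X Y : compactMetricType R)
    (K M : compactType) (hK : hausdorff_space K) (hM : hausdorff_space M)
    (T : lip R X K -> lip R Y M) (hT : lip_homomorphism T)
    (D : set (Y * M)) (phi : D -> X) (psi : D -> K)
    (hcan : has_canonical_form phi psi T) :
  compact_operator T <-> phi_supercontractive phi /\ psi_finite_fibers psi.
Proof.
split=> [cptT|[phic psifin]].
  split; first exact: compact_phi_supercontractive hcan cptT.
  exact: compact_psi_finite_fibers hcan cptT hK.
exact: supercontractive_compact_operator hcan phic psifin.
Qed.
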